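(* Let $X$ and $U$ be non-trivial complex Hilbert spaces, let $A_s\in\mathcal L(X)$ and $B_s\in\mathcal L(U,X)$, and let $x_1=(x_1(k))_{k\in\mathbb N}$, $x_0=(x_0(k))_{k\in\mathbb N}$ be Bessel sequences in $X$ and $u_0=(u_0(k))_{k\in\mathbb N}$ a Bessel sequence in $U$ such that $x_1(k)=A_sx_0(k)+B_su_0(k)$ for all $k\in\mathbb N$. Let $\Xi_1,\Xi_0\in\mathcal L(\ell^2(\mathbb N),X)$ and $\Upsilon_0\in\mathcal L(\ell^2(\mathbb N),U)$ be the synthesis operators associated with $x_1,x_0,u_0$, respectively. Then for every fixed $\gamma\in(0,1)$ the following statements are equivalent: (i) The data $(x_1,x_0,u_0)$ are informative for stabilization with decay rate $\gamma$, and there exists a stabilizing gain $K\in\mathcal L(X,U)$ with decay rate $\gamma$ for $(x_1,x_0,u_0)$ such that $$\operatorname{Ran}\begin{bmatrix}\Xi_0\\ K\Xi_0\end{bmatrix}\subseteq \operatorname{Ran}\begin{bmatrix}\Xi_0\\ \Upsilon_0\end{bmatrix}.$$ (ii) $\overline{\operatorname{Ran}\Xi_0}=X$, and there exists a densely defined linear operator $\Xi_0^\dagger$ from $X$ to $\ell^2(\mathbb N)$ with domain $D(\Xi_0^\dagger)=\operatorname{Ran}\Xi_0$ such that a) $\Xi_0\Xi_0^\dagger x=x$ for all $x\in D(\Xi_0^\dagger)$; b) $\Upsilon_0\Xi_0^\dagger$ can be extended to an operator in $\mathcal L(X,U)$; and c) $\Xi_1\Xi_0^\dagger$ can be extended to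 an operator in $\mathcal L(X)$, and this extension is power stable with decay rate $\gamma$.
   Context: $\mathcal L(Y,Z)$ denotes the bounded linear operators from $Y$ to $Z$, $\mathcal L(Y)=\mathcal L(Y,Y)$; $\mathbb N=\{1,2,\dots\}$, $\mathbb N_0=\mathbb N\cup\{0\}$; $X\times U$ carries the standard product inner product. A sequence $(\eta_k)_{k\in\mathbb N}$ in a Hilbert space $Y$ is a Bessel sequence if there is $\alpha>0$ with $\sum_{k=1}^\infty|\langle y,\eta_k\rangle|^2\le\alpha\|y\|^2$ for all $y\in Y$. Its synthesis operator is the bounded operator $\ell^2(\mathbb N)\to Y$, $w=(w_k)_{k\in\mathbb N}\mapsto\sum_{k=1}^\infty w_k\eta_k$. For $\gamma\in(0,1)$, a bounded operator $F$ is power stable with decay rate $\gamma$ if there is $M\ge1$ with $\|F^k\|\le M\gamma^k$ for all $k\in\mathbb N_0$. Define $\Sigma_{\mathrm{is}}:=\{(A,B)\in\mathcal L(X)\times\mathcal L(U,X): x_1(k)=Ax_0(k)+Bu_0(k)\ \text{for all }k\in\mathbb N\}$, and for $K\in\mathcal L(X,U)$, $M\ge1$, $\gamma>0$, $\Sigma_{K,M,\gamma}:=\{(A,B)\in\mathcal L(X)\times\mathcal L(U,X):\|(A+BK)^k\|\le M\gamma^k\ \text{for all }k\in\mathbb N_0\}$. For $\gamma\in(0,1)$, an operator $K\in\mathcal L(X,U)$ is a stabilizing gain with decay rate $\gamma$ for $(x_1,x_0,u_0)$ if $\Sigma_{\mathrm{is}}\subseteq\Sigma_{K,M,\gamma}$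 for some $M\ge1$. The data are informative for stabilization with decay rate $\gamma$ if such a $K$ exists. *)

(* Defs.v *)
From HB Require Import structures.
From mathcomp Require Import all_boot all_order all_algebra.
From mathcomp Require Import sesquilinear.
From mathcomp Require Import all_classical all_reals all_analysis.
From mathcomp Require Import complex.
From mathcomp Require Import ring lra.

Set Implicit Arguments.
Unset Strict Implicit.
Unset Printing Implicit Defensive.

Import Order.TTheory GRing.Theory Num.Def Num.Theory.
Import numFieldNormedType.Exports.

Local Open Scope classical_set_scope.
Local Open Scope ring_scope.
Local Open Scope complex_scope.

(* The norm of a normed space over [R[i]] is a nonnegative real element of
   [R[i]]; [normR] is that number as an element of [R]. *)
Definition normR (R : realType) (V : normedZmodType R[i]) (x : V) : R :=
  complex.Re `|x|.

Section NormR.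
Variable R : realType.

Lemma normRE (V : normedZmodType R[i]) (x : V) : (normR x)%:C = `|x|.
Proof. by rewrite /normR RRe_real// ger0_real. Qed.

Lemma normR_ge0 (V : normedZmodType R[i]) (x : V) : 0 <= normR x.
Proof. by rewrite -lecR normRE; exact: normr_ge0. Qed.

Lemma ler_normRD (V : normedZmodType R[i]) (x y : V) :
  normR (x + y) <= normR x + normR y.
Proof. by rewrite -lecR rmorphD /= !normRE ler_normD. Qed.

Lemma normRM (a b : R[i]) : normR (a * b) = normR a * normR b.
Proof. by apply: complexI; rewrite rmorphM /= !normRE normrM. Qed.

Lemma normR0 : normR (0 : R[i]) = 0.
Proof. by apply: complexI; rewrite normRE normr0. Qed.

Lemma normR_eq0 (a : R[i]) : normR a = 0 -> a = 0.
Proof. by move=> a0; apply/normr0_eq0; rewrite -normRE a0. Qed.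

End NormR.

(* The inner product is linear in its first argument and conjugate-linear in
   its second one. *)
HB.mixin Record CompleteNormedModule_isHilbert (R : realType) X
    of CompleteNormedModule R[i] X := {
  hdot : {dot X for @conjC R[i]} ;
  hdotxx : forall x : X, hdot x x = `|x| ^+ 2 }.

#[short(type="hilbertType")]
HB.structure Definition Hilbert (R : realType) :=
  {X of CompleteNormedModule R[i] X & CompleteNormedModule_isHilbert R X}.

Section L2.
Variable R : realType.

Definition square_summable (w : nat -> R[i]) : Prop :=
  cvgn (series (fun k => normR (w k) ^+ 2)).

Let S (w : nat -> R[i]) : R^nat := series (fun k => normR (w k) ^+ 2).

Let S_nd w : nondecreasing_seq (S w).
Proof.
by apply/nondecreasing_seqP => n; rewrite /S /series /= big_nat_recr//= lerDl
  sqr_ge0.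
Qed.

Let S_ge0 w n : 0 <= S w n.
Proof. by rewrite /S /series /= sumr_ge0// => k _; exact: sqr_ge0. Qed.

Let S_le w n : cvgn (S w) -> S w n <= limn (S w).
Proof. by move=> cw; exact: (nondecreasing_cvgn_le (@S_nd w) cw n). Qed.

Let lim_ge0 w : cvgn (S w) -> 0 <= limn (S w).
Proof. by move=> cw; exact: le_trans (S_ge0 w 0) (S_le 0 cw). Qed.

Let S_bounded w M : (forall n, S w n <= M) -> cvgn (S w).
Proof.
move=> wM; apply: nondecreasing_is_cvgn => //.
by exists M => _ [n _ <-].
Qed.

Let lim_bounded w M : (forall n, S w n <= M) -> limn (S w) <= M.
Proof.
move=> wM; apply: limr_le; first exact: S_bounded wM.
exact: nearW.
Qed.

Let SD_le v w s t n : 0 < s -> 0 < t -> S v n <= s ^+ 2 -> S w n <= t ^+ 2 ->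
  S (v + w) n <= (s + t) ^+ 2.
Proof.
move=> s0 t0 vs wt.
have pw k : normR (v k + w k) ^+ 2 <=
    (s + t) * (normR (v k) ^+ 2 / s + normR (w k) ^+ 2 / t).
  set a := normR (v k); set b := normR (w k).
  apply: (@le_trans _ _ ((a + b) ^+ 2)).
    by rewrite ler_sqr ?nnegrE ?ler_normRD ?addr_ge0 ?normR_ge0.
  rewrite -subr_ge0.
  have -> : (s + t) * (a ^+ 2 / s + b ^+ 2 / t) - (a + b) ^+ 2
      = (a * t - b * s) ^+ 2 / (s * t) by field; rewrite !gt_eqF.
  by rewrite divr_ge0 ?sqr_ge0// mulr_ge0// ltW.
apply: (@le_trans _ _ ((s + t) * (S v n / s + S w n / t))).
  rewrite /S /series /= !mulr_suml -big_split mulr_sumr /=.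
  by apply: ler_sum => k _; exact: pw.
rewrite expr2 ler_wpM2l ?addr_ge0 ?(ltW s0) ?(ltW t0)//.
by rewrite lerD// ler_pdivrMr// -expr2.
Qed.

Let SZ a w n : S (a *: w) n = normR a ^+ 2 * S w n.
Proof.
rewrite /S /series /= mulr_sumr; apply: eq_bigr => k _.
by rewrite -exprMn -normRM.
Qed.

Definition l2_pred : {pred (nat -> R[i])} := fun w => `[< square_summable w >].

Lemma l2_submod_closed : submod_closed l2_pred.
Proof.
split=> [|a v w /asboolP cv /asboolP cw]; apply/asboolP.
  apply: (@S_bounded _ 0) => n; rewrite /S /series /= big1// => k _.
  by rewrite -[0 k]/(0 : R[i]) normR0 expr0n.
have cav : cvgn (S (a *: v)).
  apply: (@S_bounded _ (normR a ^+ 2 * limn (S v))) => n.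
  by rewrite SZ ler_wpM2l ?sqr_ge0// S_le.
pose b u := Num.sqrt (limn (S u)) + 1.
have b0 u : 0 < b u by rewrite ltr_pwDr ?sqrtr_ge0.
have Sb u n : cvgn (S u) -> S u n <= b u ^+ 2.
  move=> cu; apply: (le_trans (S_le n cu)).
  rewrite -[leLHS]sqr_sqrtr ?lim_ge0// ler_sqr ?nnegrE ?sqrtr_ge0 ?ltW//.
  by rewrite ltrDl.
apply: (@S_bounded _ ((b (a *: v) + b w) ^+ 2)) => n.
by apply: SD_le; rewrite ?b0//; exact: Sb.
Qed.

HB.instance Definition _ :=
  GRing.isSubmodClosed.Build R[i] (nat -> R[i]) l2_pred l2_submod_closed.

(* Indices are shifted by one: [w k] is the entry number [k + 1] of a sequence
   indexed by {1, 2, ...}. *)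
Record l2 := L2 { l2val :> nat -> R[i]; _ : l2val \in l2_pred }.

HB.instance Definition _ := [isSub for l2val].
HB.instance Definition _ := [Choice of l2 by <:].
HB.instance Definition _ := [SubChoice_isSubLmodule of l2 by <:].

Definition l2norm (w : l2) : R[i] :=
  (Num.sqrt (limn (series (fun k => normR (w k) ^+ 2))))%:C.

Let l2P (w : l2) : cvgn (S w).
Proof. by case: w => w /= /asboolP. Qed.

Lemma ler_l2normD (v w : l2) : l2norm (v + w) <= l2norm v + l2norm w.
Proof.
rewrite /l2norm -rmorphD /= lecR.
apply/ler_addgt0Pr => e e0.
pose b (u : l2) := Num.sqrt (limn (S u)) + e / 2.
have e20 : 0 < e / 2 by rewrite divr_gt0.
have b0 u : 0 < b u by rewrite ltr_pwDr ?sqrtr_ge0.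
have Sb (u : l2) n : S u n <= b u ^+ 2.
  apply: (le_trans (S_le n (@l2P u))).
  rewrite -[leLHS]sqr_sqrtr ?lim_ge0 ?l2P// ler_sqr ?nnegrE ?sqrtr_ge0 ?ltW//.
  by rewrite ltrDl.
apply: (@le_trans _ _ (b v + b w)); last by rewrite /b /S; lra.
rewrite -[leRHS]ger0_norm; last by rewrite addr_ge0 ?ltW.
rewrite -sqrtr_sqr ler_wsqrtr//.
by apply: (@lim_bounded ((v : nat -> R[i]) + w)) => n; apply: SD_le.
Qed.

Lemma l2normZ (a : R[i]) (w : l2) : l2norm (a *: w) = `|a| * l2norm w.
Proof.
rewrite /l2norm -normRE -rmorphM /=; congr (_%:C).
have -> : limn (series (fun k => normR ((a *: w) k) ^+ 2))
    = normR a ^+ 2 * limn (S w).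
  rewrite -[X in limn X]/(S (a *: (w : nat -> R[i]))).
  rewrite (_ : S _ = fun n => normR a ^+ 2 * S w n); last first.
    by apply/funext => n; exact: SZ.
  by apply: cvg_lim => //; apply: cvgMr; exact: l2P.
by rewrite sqrtrM ?sqr_ge0// sqrtr_sqr ger0_norm// normR_ge0.
Qed.

Lemma l2norm_eq0 (w : l2) : l2norm w = 0 -> w = 0.
Proof.
move=> /complexI /eqP; rewrite sqrtr_eq0 => w0.
apply/val_inj/funext => k /=; apply/normR_eq0/eqP; rewrite -sqrf_eq0.
rewrite eq_le sqr_ge0 andbT (le_trans _ w0)//.
apply: le_trans (S_le k.+1 (@l2P w)).
by rewrite /S /series /= big_nat_recr//= lerDr; exact: S_ge0.
Qed.

HB.instance Definition _ :=
  Lmodule_isNormed.Build R[i] l2 ler_l2normD l2normZ l2norm_eq0.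

End L2.

HB.mixin Record isBoundedMap (R : realType) (Y Z : normedModType R[i])
    (f : Y -> Z) := {
  bounded_map : exists C : R, forall y, normR (f y) <= C * normR y }.

#[short(type="boundedOp")]
HB.structure Definition BoundedOp (R : realType) (Y Z : normedModType R[i]) :=
  {f of isBoundedMap R Y Z f & @GRing.Linear R[i] Y Z *:%R f}.

Notation "''L' ( Y , Z )" := (boundedOp Y Z)
  (at level 8, format "''L' ( Y ,  Z )") : type_scope.

Section Operators.
Variable R : realType.
Implicit Types Y Z : normedModType R[i].

Definition opnorm Y Z (f : Y -> Z) : R :=
  sup [set normR (f y) | y in [set y | normR y <= 1]].

Definition power_stable Y (gamma : R) (F : 'L(Y, Y)) : Prop :=
  exists2 M : R, 1 <= M & forall k, opnorm (iter k F) <= M * gamma ^+ k.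

(* A linear operator from [Y] to [Z] defined on a subspace of [Y]; the values
   of [pop] outside of [dom] are irrelevant. *)
Record partial_op Y Z := PartialOp {
  dom : set Y ;
  pop :> Y -> Z ;
  dom0 : dom 0 ;
  domP : forall a x y, dom x -> dom y -> dom (a *: x + y) ;
  pop_linear : forall a x y, dom x -> dom y ->
    pop (a *: x + y) = a *: pop x + pop y }.

Definition densely_defined Y Z (T : partial_op Y Z) : Prop :=
  closure (dom T) = setT.

(* [F] extends the composition [G T], whose domain is [dom T]. *)
Definition extends_comp Y Z W (F : 'L(Y, W)) (G : 'L(Z, W))
    (T : partial_op Y Z) : Prop :=
  forall y, dom T y -> F y = G (T y).

End Operators.

(* All sequences indexed by {1, 2, ...} are shifted to start at index [0]. *)
Section Data.
Variables (R : realType) (X U : hilbertType R).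

Definition bessel (Y : hilbertType R) (eta : nat -> Y) : Prop :=
  exists2 alpha : R, 0 < alpha & forall y : Y,
    (\sum_(0 <= k <oo) (normR (hdot y (eta k)) ^+ 2)%:E <=
      (alpha * normR y ^+ 2)%:E)%E.

Definition synthesis (Y : hilbertType R) (eta : nat -> Y)
    (Xi : 'L(l2 R, Y)) : Prop :=
  forall w : l2 R, series (fun k => w k *: eta k) @ \oo --> Xi w.

Definition Sigma_is (x1 x0 : nat -> X) (u0 : nat -> U) :
    set ('L(X, X) * 'L(U, X)) :=
  [set AB : 'L(X, X) * 'L(U, X) | forall k, x1 k = AB.1 (x0 k) + AB.2 (u0 k)].

Definition Sigma_gain (K : 'L(X, U)) (M gamma : R) :
    set ('L(X, X) * 'L(U, X)) :=
  [set AB : 'L(X, X) * 'L(U, X) | forall k,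
    opnorm (iter k (AB.1 \+ (AB.2 \o K))) <= M * gamma ^+ k].

Definition stabilizing_gain (gamma : R) (x1 x0 : nat -> X) (u0 : nat -> U)
    (K : 'L(X, U)) : Prop :=
  exists2 M : R, 1 <= M & Sigma_is x1 x0 u0 `<=` Sigma_gain K M gamma.

Definition informative_for_stabilization (gamma : R) (x1 x0 : nat -> X)
    (u0 : nat -> U) : Prop :=
  exists K, stabilizing_gain gamma x1 x0 u0 K.

End Data.

(* Main.v *)
(* If [K] is a stabilizing gain and [z] is orthogonal to the range of [Xi0], then
   [As + c z<., z>] is compatible with the data for every scalar [c], while
   [As + c z<., z> + Bs K] has norm at most [M gamma]; hence [z = 0] and [Xi0] has
   dense range. The range inclusion says that [Xi0] already attains its whole range
   on the subspace [Ups0 w = K Xi0 w], so a linear section of [Xi0] with values in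
   this subspace serves as [Xi0dag]; [K] and [As + Bs K] are then the extensions
   asked for. Conversely, a compatible pair satisfies [Xi1 = A Xi0 + B Ups0], so the
   extensions [K] and [F] of [Ups0 Xi0dag] and [Xi1 Xi0dag] satisfy [F = A + B K] on
   the dense range of [Xi0], hence everywhere, for every compatible [(A, B)]. *)

Require Import Defs.
From HB Require Import structures.
From mathcomp Require Import all_boot all_order all_algebra sesquilinear.
From mathcomp Require Import all_classical all_reals all_analysis.
From mathcomp Require Import complex.
From mathcomp Require Import ring lra.

Set Implicit Arguments.
Unset Strict Implicit.
Unset Printing Implicit Defensive.

Import Order.TTheory GRing.Theory Num.Theory.
Import numFieldNormedType.Exports.

Local Open Scope classical_set_scope.
Local Open Scope ring_scope.

(** * Subspaces on which a linear map is injective *)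

Section LinearSection.
Variables (F : fieldType) (V Z : lmodType F).
Implicit Types A W : set V.

Definition lsubspace A := A 0 /\ forall a v w, A v -> A w -> A (a *: v + w).

Lemma lsubspaceD A v w : lsubspace A -> A v -> A w -> A (v + w).
Proof. by move=> [_ sA] Av Aw; rewrite -[v]scale1r; exact: sA. Qed.

Lemma lsubspaceZ A a v : lsubspace A -> A v -> A (a *: v).
Proof. by move=> [A0 sA] Av; rewrite -[_ *: v]addr0; exact: sA. Qed.

Lemma lsubspaceB A v w : lsubspace A -> A v -> A w -> A (v - w).
Proof.
by move=> sA Av Aw; rewrite addrC -scaleN1r; exact: sA.2.
Qed.

(** Zorn's lemma gives a maximal subspace [A] of [W] on which [f] is injective. If some [f w] with
    [w] in [W] were not attained on [A], then [f] would still be injective on [A] plus the span of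
    [w]. *)
Lemma exists_complement_ker (f : {linear V -> Z}) W : lsubspace W ->
  exists A, [/\ lsubspace A, A `<=` W, forall v, A v -> f v = 0 -> v = 0 &
    f @` W `<=` f @` A].
Proof.
move=> sW.
(* The empty chain has union [set0], so [0] is not required of members. *)
pose P A := [/\ forall a v w, A v -> A w -> A (a *: v + w), A `<=` W &
  forall v, A v -> f v = 0 -> v = 0].
have [C CP Ctot|A [[lA AW Ainj] Amax]] := @Zorn_bigcup V P.
  split=> [a v w [A CA Av] [B CB Bw]|v [A /CP[_ AW _] /AW]//|v [A /CP[_ _ +] Av]].
  - have [AB|BA] := Ctot _ _ CA CB.
      by exists B => //; have [lB _ _] := CP _ CB; apply: lB => //; exact: AB.
    by exists A => //; have [lA _ _] := CP _ CA; apply: lA => //; exact: BA.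
  - exact.
(* Any element [v] of [A] puts [- v + v] in [A], and an empty [A] would not be maximal, since
   [[set 0]] is admissible. *)
have A0 : A 0.
  apply: contrapT => nA0.
  have eA v : ~ A v.
    move=> Av; apply: nA0.
    by have := lA (-1) v v Av Av; rewrite scaleN1r addNr.
  apply: (Amax [set 0]).
    by split=> [v /eA//|E]; exact/nA0/E.
  split=> [a v w -> ->|v ->|v ->//]; first by rewrite scaler0 addr0.
  exact: sW.1.
exists A; split=> // _ [w Ww <-].
apply: contrapT => nfw.
have sA : lsubspace A by split.
pose B := [set v + a *: w | v in A & a in [set: F]].
apply: (Amax B); last split.
- split=> [v Av|E]; first by exists v => //; exists 0 => //; rewrite scale0r addr0.
  apply: nfw; exists w => //; apply: E.
  by exists 0 => //; exists 1 => //; rewrite scale1r add0r.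
- move=> a _ _ [v Av [b _ <-]] [v' Av' [b' _ <-]].
  exists (a *: v + v'); first exact: lA.
  by exists (a * b + b') => //; rewrite scalerDr scalerDl scalerA addrACA.
- by move=> _ [v Av [b _ <-]]; apply: lsubspaceD => //; [exact: AW|exact: lsubspaceZ].
- move=> _ [v Av [b _ <-]]; have [->|b0] := eqVneq b 0.
    by rewrite scale0r addr0; exact: Ainj.
  rewrite linearD linearZ /= => fvw; exfalso; apply: nfw.
  exists (- b^-1 *: v); first exact: lsubspaceZ.
  rewrite linearZ /=.
  have /eqP -> : f v == - (b *: f w) by rewrite -addr_eq0 fvw.
  by rewrite scalerN scaleNr opprK scalerA mulVf// scale1r.
Qed.

End LinearSection.

(** * Bounded operators between normed spaces *)

Section BoundedOperators.
Variable R : realType.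
Implicit Types Y Z W : normedModType R[i].

Lemma normR_ltE Y (y : Y) (e : R) : (normR y < e) = (`|y| < e%:C)%C.
Proof. by rewrite -normRE ltcR. Qed.

Lemma normRZ Y (a : R[i]) (y : Y) : normR (a *: y) = normR a * normR y.
Proof. by apply: complexI; rewrite rmorphM /= !normRE normrZ. Qed.

Lemma normR_real (r : R) : normR (r%:C)%C = `|r|.
Proof. by apply: complexI; rewrite normRE normc_def /= expr0n addr0 sqrtr_sqr. Qed.

Lemma normRB Y (x y : Y) : normR (x - y) = normR (y - x).
Proof. by apply: complexI; rewrite !normRE distrC. Qed.

Lemma cvg_normRP Y {T} (F : set_system T) {FF : Filter F} (u : T -> Y) (l : Y) :
  u x @[x --> F] --> l <-> forall e, 0 < e -> \forall x \near F, normR (l - u x) < e.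
Proof.
split=> [/cvgrPdist_lt ul e e0|ul].
  have := ul (e%:C)%C; rewrite ltcR => /(_ e0).
  by apply: filterS => x; rewrite normR_ltE.
apply/cvgrPdist_lt => e e0.
(* A positive element of [R[i]] is real, so real radii suffice. *)
have eE : e = ((complex.Re e)%:C)%C by rewrite RRe_real// gtr0_real.
rewrite eE in e0 *; rewrite ltcR in e0.
by apply: filterS (ul _ e0) => x; rewrite normR_ltE.
Qed.

(** A positive constant can be divided by and cancelled in later estimates. *)
Lemma boundedP Y Z (f : 'L(Y, Z)) :
  exists2 C : R, 0 < C & forall y, normR (f y) <= C * normR y.
Proof.
have [C fC] := @bounded_map _ _ _ f; exists (`|C| + 1); first by rewrite ltr_wpDl.
move=> y; apply: le_trans (fC y) _; rewrite ler_wpM2r ?normR_ge0//.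
by rewrite (le_trans (ler_norm _))// lerDl.
Qed.

Lemma boundedOp_continuous Y Z (f : 'L(Y, Z)) : continuous f.
Proof.
have [C C0 fC] := boundedP f => x.
apply/cvg_normRP => e e0.
have /cvg_normRP/(_ (e / C)) := @cvg_id _ (nbhs x).
move=> /(_ (divr_gt0 e0 C0)); apply: filterS => y.
rewrite ltr_pdivlMr// mulrC -linearB; exact: le_lt_trans (fC _).
Qed.

Lemma mk_boundedOp Y Z (f : Y -> Z) (C : R) : linear f ->
  (forall y, normR (f y) <= C * normR y) -> exists g : 'L(Y, Z), g =1 f.
Proof.
move=> lf fC.
pose L := GRing.isLinear.Build R[i] Y Z *:%R f lf.
pose B := isBoundedMap.Build R Y Z f (ex_intro _ C fC).
pose g : 'L(Y, Z) := HB.pack f L B.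
by exists g.
Qed.

Lemma boundedOp_comp Y Z W (f : 'L(Z, W)) (g : 'L(Y, Z)) :
  exists h : 'L(Y, W), h =1 f \o g.
Proof.
have [C C0 fC] := boundedP f; have [D D0 gD] := boundedP g.
apply: (@mk_boundedOp _ _ _ (C * D)) => [a x y|y]; first by rewrite /= !linearP.
by apply: le_trans (fC _) _; rewrite -mulrA ler_pM2l.
Qed.

(** Serves both for sums, with [c = 1], and for perturbations of arbitrary size. *)
Lemma boundedOp_addsc Y Z (f g : 'L(Y, Z)) (c : R[i]) :
  exists h : 'L(Y, Z), forall y, h y = f y + c *: g y.
Proof.
have [C C0 fC] := boundedP f; have [D D0 gD] := boundedP g.
apply: (@mk_boundedOp _ _ _ (C + normR c * D)) => [a x y|y].
  by rewrite !linearP /= !scalerDr !scalerA addrACA.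
apply: le_trans (ler_normRD _ _) _; rewrite mulrDl lerD// normRZ -mulrA.
by rewrite ler_wpM2l// normR_ge0.
Qed.

(** Boundedness of [f] makes the [sup] in [opnorm] a genuine supremum and not a default value. *)
Lemma le_opnorm Y Z (f : 'L(Y, Z)) y : normR y <= 1 -> normR (f y) <= opnorm f.
Proof.
move=> y1; have [C C0 fC] := boundedP f.
apply: ub_le_sup; last by exists y.
exists C => _ [x /= x1 <-]; apply: le_trans (fC x) _.
by rewrite -[leRHS]mulr1 ler_pM2l.
Qed.

(** The zero set of [f - g] is closed and contains [S]. *)
Lemma continuous_eq_dense Y Z (f g : Y -> Z) (S : set Y) :
  continuous f -> continuous g -> closure S = setT ->
  (forall y, S y -> f y = g y) -> f =1 g.
Proof.
move=> cf cg dS fg y; apply/eqP; rewrite -subr_eq0; apply/eqP.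
pose h z := f z - g z.
have ch : continuous h by move=> z; apply: cvgB; [exact: cf|exact: cg].
have cl0 : closed (h @^-1` [set 0]).
  apply: preimage_closed => [z _|]; first exact: ch.
  by apply: accessible_closed_set1; apply: hausdorff_accessible; exact: norm_hausdorff.
apply: cl0; apply: (@closure_subset _ S); last by rewrite dS.
by move=> z /fg; rewrite /h /= => ->; rewrite subrr.
Qed.

End BoundedOperators.

(** * Orthogonality in Hilbert spaces *)

Section HilbertGeometry.
Variables (R : realType) (X : hilbertType R).
Implicit Types (x y z s : X) (S : set X).

Lemma normR_gt0 x : (0 < normR x) = (x != 0).
Proof. by rewrite -ltcR normRE normr_gt0. Qed.

Lemma sqr_normR x : ((normR x ^+ 2)%:C)%C = hdot x x.
Proof. by rewrite rmorphXn /= normRE -hdotxx. Qed.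

(** With [a = hdot z s / hdot s s], the vector [a *: s] is the orthogonal projection of [z] on the
    line through [s]. Both Cauchy-Schwarz and the orthogonality of a minimizer follow from this
    identity. *)
Lemma sqr_normR_sub_proj z s : s != 0 -> exists a : R[i],
  normR (z - a *: s) ^+ 2 = normR z ^+ 2 - normR (hdot z s) ^+ 2 / normR s ^+ 2.
Proof.
move=> s0; exists (hdot z s / hdot s s); apply: complexI.
have ss0 : hdot s s != 0 by rewrite hdotxx sqrf_eq0 normr_eq0.
have ssC : (hdot s s)^*%R = hdot s s by rewrite conj_Creal// ger0_real// dnorm_ge0.
rewrite sqr_normR rmorphB /= fmorph_div /= !sqr_normR.
rewrite rmorphXn /= normRE normCK.
rewrite dnormB dnormZ linearZr_LR /= normCK !rmorphM /= !fmorphV /= !ssC conjCK.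
by field.
Qed.

Lemma cauchy_schwarz z s : normR (hdot z s) <= normR z * normR s.
Proof.
have [->|s0] := eqVneq s 0; first by rewrite linear0r normR0 mulr_ge0 ?normR_ge0.
have [a az] := sqr_normR_sub_proj z s0.
have := sqr_ge0 (normR (z - a *: s)); rewrite az subr_ge0.
rewrite ler_pdivrMr ?exprn_gt0 ?normR_gt0// -exprMn ler_sqr// nnegrE.
- exact: normR_ge0.
- by rewrite mulr_ge0 ?normR_ge0.
Qed.

Lemma parallelogram x y : normR (x + y) ^+ 2 + normR (x - y) ^+ 2 =
  2 * (normR x ^+ 2 + normR y ^+ 2).
Proof.
apply: complexI; rewrite mulr_natl rmorphMn !rmorphD /= !sqr_normR dnormD dnormB.
by rewrite mulr2n; ring.
Qed.

Lemma boundedOp_rank1 z : exists T : 'L(X, X), forall x, T x = hdot x z *: z.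
Proof.
apply: (@mk_boundedOp _ _ _ _ (normR z * normR z)) => [a x y|x].
  by rewrite linearPl /= scalerDl scalerA.
by rewrite normRZ mulrAC ler_wpM2r ?normR_ge0// mulrC cauchy_schwarz.
Qed.

Lemma exists_orthogonal S : lsubspace S -> closure S != setT ->
  exists2 z, z != 0 & forall s, S s -> hdot s z = 0.
Proof.
move=> sS /eqP dS.
have [y ySN] : exists y, ~ closure S y.
  apply: contrapT => h; apply: dS; apply/seteqP; split=> // y _.
  by apply: contrapT => yS; apply: h; exists y.
pose E := [set normR (y - s) ^+ 2 | s in S].
have Elb : has_lbound E by exists 0 => _ [s _ <-]; exact: sqr_ge0.
have [S0 _] := sS.
have Einf : has_inf E by split=> //; exists (normR (y - 0) ^+ 2); exists 0.
pose d := inf E.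
have dE s : S s -> d <= normR (y - s) ^+ 2.
  by move=> Ss; apply: ge_inf => //; exists s.
have [u uP] : {u : nat -> X & forall n, S (u n) /\
    normR (y - u n) ^+ 2 < d + n.+1%:R^-1}.
  apply: (@choice _ _ (fun n s => S s /\ normR (y - s) ^+ 2 < d + n.+1%:R^-1)) => n.
  have [|_ [s Ss <-] sd] := @inf_adherent _ E n.+1%:R^-1 _ Einf.
    by rewrite invr_gt0.
  by exists s.
(* A minimizing sequence [u] for the distance of [y] to [S] is Cauchy; [y] minus its
   limit is the orthogonal vector. *)
have u_close m n : normR (u m - u n) ^+ 2 < 2 * (m.+1%:R^-1 + n.+1%:R^-1).
  have [[Sm um] [Sn un]] := (uP m, uP n).
  (* The midpoint of [u m] and [u n] lies in [S], so the sum of these two vectors has squared norm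
     at least [4 * d]. *)
  have := parallelogram (y - u m) (y - u n).
  have -> : y - u m - (y - u n) = u n - u m by rewrite opprB addrC addrA subrK.
  have -> : y - u m + (y - u n) = ((2%:R : R)%:C)%C *: (y - ((2^-1 : R)%:C)%C *: (u m + u n)).
    rewrite scalerBr scalerA -rmorphM /= mulfV// rmorph1 scale1r rmorph_nat.
    by rewrite scaler_nat mulr2n opprD addrACA.
  rewrite normRZ normR_real exprMn real_normK ?num_real// (normRB (u m)).
  have := dE (((2^-1 : R)%:C)%C *: (u m + u n)).
  move/(_ (lsubspaceZ _ sS (lsubspaceD sS Sm Sn))).
  by move: um un; move: m.+1%:R^-1 n.+1%:R^-1 => c e; lra.
have /cauchy_cvgP/cvg_ex[p up] : cauchy (u @ \oo).
  apply: cauchy_exP => e e0.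
  have eE : e = ((complex.Re e)%:C)%C by rewrite RRe_real// gtr0_real.
  rewrite eE in e0 *; rewrite ltcR in e0; set r := complex.Re e in e0 *.
  (* Two reciprocals below [r ^+ 2 / 4] bring the bound of [u_close] below [r ^+ 2]. *)
  have r4 : 0 < r ^+ 2 / 4 by rewrite divr_gt0// exprn_gt0.
  have [N _ NP] := near_infty_natSinv_lt (PosNum r4).
  exists (u N), N => // n /= Nn.
  rewrite -ball_normE /= -normR_ltE.
  rewrite -ltr_sqr ?nnegrE ?normR_ge0 ?(ltW e0)//.
  apply: lt_trans (u_close _ _) _.
  have := NP N (leqnn N); have := NP n Nn; rewrite /=.
  by move: N.+1%:R^-1 n.+1%:R^-1 => c b; lra.
have Sp : closure S p.
  apply: (@closed_cvg _ _ \oo _ u) up; first exact: closed_closure.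
  by apply: nearW => n; apply: subset_closure; exact: (uP n).1.
exists (y - p).
  by apply/eqP => /eqP; rewrite subr_eq0 => /eqP yp; apply: ySN; rewrite yp.
move=> s Ss; apply/eqP; rewrite herm_eq0C; apply/eqP.
have [->|s0] := eqVneq s 0; first by rewrite linear0r.
apply: normR_eq0; apply/eqP; rewrite eq_le normR_ge0 andbT.
apply/ler_addgt0Pr => e e0; rewrite add0r.
have ns0 : 0 < normR s by rewrite normR_gt0.
(* Splitting [y - p] at [u n] leaves two inner products with [s], each at most
   [r * normR s = e / 2]. *)
pose r := e / 2 / normR s.
have r0 : 0 < r by rewrite !divr_gt0.
have /cvg_normRP/(_ _ r0) upr := up.
have r20 : 0 < r ^+ 2 by rewrite exprn_gt0.
have [n [upn nr]] : exists n, normR (p - u n) < r /\ n.+1%:R^-1 < r ^+ 2.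
  have [N _ NP] := filterI upr (near_infty_natSinv_lt (PosNum r20)).
  by exists N; exact: NP N (leqnn N).
have [Sn un] := uP n.
have [a aE] := sqr_normR_sub_proj (y - u n) s0.
(* Moving from [u n] to [u n + a *: s] stays in [S], so it cannot lower the squared distance to [y]
   below [d]; the decrease is therefore less than [n.+1%:R^-1]. *)
have := dE _ (lsubspaceD sS Sn (lsubspaceZ a sS Ss)); rewrite opprD addrA aE => dle.
have h1 : normR (hdot (y - u n) s) ^+ 2 / normR s ^+ 2 < r ^+ 2
  by move: un nr dle; move: n.+1%:R^-1 (_ / _ : R) => q b; lra.
rewrite ltr_pdivrMr ?exprn_gt0// -exprMn ltr_sqr in h1; last 2 first.
- by rewrite nnegrE normR_ge0.
- by rewrite nnegrE mulr_ge0 ?ltW.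
have -> : y - p = (y - u n) + (u n - p) by rewrite addrA subrK.
rewrite linearDl; apply: le_trans (ler_normRD _ _) _.
have -> : e = r * normR s + r * normR s by rewrite /r divfK ?gt_eqF//; lra.
apply: lerD; first exact: ltW.
apply: le_trans (cauchy_schwarz _ _) _.
by rewrite ler_wpM2r ?(ltW ns0)// normRB ltW.
Qed.

End HilbertGeometry.

(** * Synthesis operators and pairs compatible with the data *)

Section Synthesis.
Variable R : realType.

Lemma cvg_series_single (K : numFieldType) (V : normedModType K) (k : nat) (a : V) :
  series (fun j => if j == k then a else 0) @ \oo --> a.
Proof.
apply: cvg_near_cst; exists k.+1 => // n /= kn.
by rewrite /series /= -big_mkcond big_nat1_eq /= kn.
Qed.

(** [eta k] is the image of the unit sequence supported at [k]. *)
Lemma synthesis_range (Y : hilbertType R) (eta : nat -> Y) (Xi : 'L(l2 R, Y)) k :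
  synthesis eta Xi -> range Xi (eta k).
Proof.
move=> XiE; pose e j : R[i] := (j == k)%:R.
have eP : e \in @l2_pred R.
  apply/asboolP/cvg_ex; exists 1.
  rewrite /series /= (_ : (fun _ => _) = series (fun j => if j == k then 1 else 0)).
    exact: cvg_series_single.
  apply/funext => n; apply: eq_bigr => j _; rewrite /e.
  by case: eqP => _; rewrite ?normR0 ?expr0n// (@normR_real _ 1) normr1 expr1n.
exists (L2 eP) => //.
apply: (cvg_unique _ (XiE _)); first exact: norm_hausdorff.
rewrite (_ : (fun _ => _) = fun j => if j == k then eta k else 0).
  exact: cvg_series_single.
by apply/funext => j /=; rewrite /e; case: eqP => [->|_]; rewrite ?scale1r ?scale0r.
Qed.

Variables X U : hilbertType R.

(** The identity holds for partial sums by linearity and passes to the limit by continuity of [A]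
    and [B]. *)
Lemma synthesis_Sigma_is (x1 x0 : nat -> X) (u0 : nat -> U)
    (Xi1 Xi0 : 'L(l2 R, X)) (Ups0 : 'L(l2 R, U)) (A : 'L(X, X)) (B : 'L(U, X)) :
  synthesis x1 Xi1 -> synthesis x0 Xi0 -> synthesis u0 Ups0 ->
  Sigma_is x1 x0 u0 (A, B) -> forall w, Xi1 w = A (Xi0 w) + B (Ups0 w).
Proof.
move=> S1 S0 SU AB w.
apply: (cvg_unique _ (S1 w)); first exact: norm_hausdorff.
rewrite (_ : series _ = (fun n => A (series (fun k => w k *: x0 k) n) +
    B (series (fun k => w k *: u0 k) n))); last first.
  apply/funext => n; rewrite /series /= !linear_sum -big_split /=.
  by apply: eq_bigr => k _; rewrite AB !linearZ /= scalerDr.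
apply: cvgD.
  exact: (continuous_cvg _ (@boundedOp_continuous _ _ _ A _) (S0 w)).
exact: (continuous_cvg _ (@boundedOp_continuous _ _ _ B _) (SU w)).
Qed.

Lemma stabilizing_gain_dense (x1 x0 : nat -> X) (u0 : nat -> U)
    (Xi0 : 'L(l2 R, X)) (As : 'L(X, X)) (Bs : 'L(U, X)) (K : 'L(X, U)) gamma :
  synthesis x0 Xi0 -> Sigma_is x1 x0 u0 (As, Bs) ->
  stabilizing_gain gamma x1 x0 u0 K -> closure (range Xi0) = setT.
Proof.
move=> S0 ABs [M _ KM]; apply: contrapT => /eqP dS.
have sS : lsubspace (range Xi0).
  split=> [|a _ _ [v _ <-] [w _ <-]]; first by exists 0 => //; exact: linear0.
  by exists (a *: v + w) => //; exact: linearP.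
have [z z0 zS] := exists_orthogonal sS dS.
have [T TE] := boundedOp_rank1 z.
have [BK BKE] := boundedOp_comp Bs K.
have [H HE] := boundedOp_addsc As BK 1.
pose y := ((normR z)^-1%:C)%C *: z.
have nz : 0 < normR z by rewrite normR_gt0.
have y1 : normR y = 1 by rewrite normRZ normR_real ger0_norm ?invr_ge0 ?ltW// mulVf ?gt_eqF.
have Ty : normR (T y) = normR z ^+ 2.
  rewrite TE /y linearZl_LR /= normRZ normRM -(sqr_normR z) !normR_real.
  rewrite !ger0_norm ?invr_ge0 ?exprn_ge0 ?normR_ge0//.
  by field; rewrite gt_eqF.
(* The decay bound at exponent 1, evaluated at the unit vector [y], controls [c *: T y = G y - H y]
   uniformly in [c]. *)
have bnd (c : R) : `|c| * normR (T y) <= M * gamma + normR (H y).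
  have [Ac AcE] := boundedOp_addsc As T (c%:C)%C.
  have [G GE] := boundedOp_addsc H T (c%:C)%C.
  have : Sigma_gain K M gamma (Ac, Bs).
    apply: KM => k /=; rewrite AcE TE zS; last exact: synthesis_range.
    by rewrite scale0r scaler0 addr0; exact: ABs.
  move/(_ 1%N); rewrite expr1 /= => GM.
  have GyM : normR (G y) <= M * gamma.
    apply: le_trans GM; rewrite (_ : _ \+ _ = G); first by apply: le_opnorm; rewrite y1.
    by apply/funext => x /=; rewrite AcE GE HE BKE scale1r /= addrAC.
  have -> : `|c| * normR (T y) = normR (G y - H y).
    by rewrite GE addrAC subrr add0r normRZ normR_real.
  apply: le_trans (ler_normRD _ _) _; rewrite lerD//.
  by rewrite -[- H y]sub0r normRB subr0.
have Ty0 : 0 < normR (T y) by rewrite Ty exprn_gt0.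
(* This [c] makes the left side exceed the right side by at least 1; the absolute value keeps [c]
   nonnegative whatever the sign of [gamma]. *)
have := bnd ((`|M * gamma + normR (H y)| + 1) / normR (T y)).
rewrite ger0_norm; last by rewrite divr_ge0 ?addr_ge0 ?(ltW Ty0).
rewrite divfK ?gt_eqF// => h.
have := ler_norm (M * gamma + normR (H y)); lra.
Qed.

End Synthesis.

(** * Linear sections and the equivalence *)

(** Preimages are chosen in a subspace [A] of [W] on which [f] is injective. Their uniqueness there
    forces the choice to be linear. *)
Lemma exists_partial_section (R : realType) (X Z : normedModType R[i])
    (f : {linear Z -> X}) (W : set Z) :
  lsubspace W -> range f `<=` f @` W ->
  exists T : partial_op X Z, dom T = range f /\
    forall x, dom T x -> f (T x) = x /\ W (T x).
Proof.
move=> sW fW; have [A [sA AW Ainj fA]] := exists_complement_ker f sW.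
pose g x := xget 0 [set v | A v /\ f v = x].
have gP x : range f x -> A (g x) /\ f (g x) = x.
  move=> /fW/fA[v Av fv].
  by apply: (@xgetPex _ 0 [set v | A v /\ f v = x]); exists v.
have r0 : range f 0 by exists 0 => //; exact: linear0.
have rP a x y : range f x -> range f y -> range f (a *: x + y).
  by move=> [v _ <-] [w _ <-]; exists (a *: v + w) => //; exact: linearP.
have glin a x y : range f x -> range f y -> g (a *: x + y) = a *: g x + g y.
  move=> rx ry; apply/eqP; rewrite -subr_eq0; apply/eqP.
  have [[[Ax fx] [Ay fy]] [Axy fxy]] := (gP _ rx, gP _ ry, gP _ (rP a _ _ rx ry)).
  apply: Ainj; first by apply: lsubspaceB => //; exact: (sA.2 a _ _ Ax Ay).
  by rewrite linearB linearP fx fy fxy subrr.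
exists (PartialOp r0 rP glin); split=> // x /gP[Agx fgx].
by split=> //; exact: AW.
Qed.

Unset Implicit Arguments.
Set Strict Implicit.
Set Printing Implicit Defensive.

Theorem theorem4p1 (R : realType) (X U : hilbertType R)
  (X_nontrivial : exists x : X, x != 0) (U_nontrivial : exists u : U, u != 0)
  (As : 'L(X, X)) (Bs : 'L(U, X))
  (x1 x0 : nat -> X) (u0 : nat -> U)
  (x1_bessel : bessel x1) (x0_bessel : bessel x0) (u0_bessel : bessel u0)
  (data : forall k, x1 k = As (x0 k) + Bs (u0 k))
  (Xi1 Xi0 : 'L(l2 R, X)) (Ups0 : 'L(l2 R, U))
  (Xi1_synthesis : synthesis x1 Xi1) (Xi0_synthesis : synthesis x0 Xi0)
  (Ups0_synthesis : synthesis u0 Ups0)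
  (gamma : R) (gamma_gt0 : 0 < gamma) (gamma_lt1 : gamma < 1) :
  (informative_for_stabilization gamma x1 x0 u0 /\
   exists K : 'L(X, U), stabilizing_gain gamma x1 x0 u0 K /\
     range (fun w : l2 R => (Xi0 w, K (Xi0 w))) `<=`
     range (fun w : l2 R => (Xi0 w, Ups0 w)))
  <->
  (closure (range Xi0) = setT /\
   exists Xi0dag : partial_op X (l2 R),
     [/\ densely_defined Xi0dag, dom Xi0dag = range Xi0,
         forall x, dom Xi0dag x -> Xi0 (Xi0dag x) = x,
         exists G : 'L(X, U), extends_comp G Ups0 Xi0dag &
         exists F : 'L(X, X), extends_comp F Xi1 Xi0dag /\ power_stable gamma F]).
Proof.
split=> [[_ [K [Kstab KR]]]|[dXi0 [Xi0dag [_ domE dagK [K KE] [F [FE [M M1 FM]]]]]]].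
- have dXi0 := stabilizing_gain_dense Xi0_synthesis data Kstab.
  split=> //.
  have sW : lsubspace [set w | Ups0 w = K (Xi0 w)].
    by split=> [|a v w /= vK wK]; rewrite /= ?linear0// !linearP /= vK wK.
  have [x [w _ <-]|dag [domE dagP]] := exists_partial_section (f := Xi0) sW.
    have [v _ [vw vK]] := KR _ (ex_intro2 _ _ w I erefl).
    by exists v => //; rewrite /= vK vw.
  exists dag; split=> //; first by rewrite /densely_defined domE.
  + by move=> x /dagP[].
  + by exists K => x /dagP[/= fx ->]; rewrite fx.
  have [BK BKE] := boundedOp_comp Bs K.
  have [F FE] := boundedOp_addsc As BK 1.
  have FfunE : (F : X -> X) = As \+ (Bs \o K).
    by apply/funext => x; rewrite FE BKE scale1r.
  exists F; split.
    move=> x /dagP[/= fx gx].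
    rewrite (synthesis_Sigma_is Xi1_synthesis Xi0_synthesis Ups0_synthesis data).
    by rewrite FfunE /= gx fx.
  have [M M1 KM] := Kstab; exists M => // k; rewrite FfunE.
  exact: (KM (As, Bs) data k).
- have Kstab : stabilizing_gain gamma x1 x0 u0 K.
    (* [M] comes from the power stability of [F], hence is the same for every compatible pair. *)
    exists M => // -[A B] AB k /=.
    rewrite (_ : _ \+ _ = F) //.
    have [BK BKE] := boundedOp_comp B K.
    have [H HE] := boundedOp_addsc A BK 1.
    apply/funext => x; rewrite /= -[B (K x)]BKE -[BK x]scale1r -HE.
    apply: (continuous_eq_dense _ _ dXi0); [exact: boundedOp_continuous..|].
    rewrite -domE => y yd; rewrite FE// HE BKE scale1r /=.
    rewrite (synthesis_Sigma_is Xi1_synthesis Xi0_synthesis Ups0_synthesis AB).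
    by rewrite dagK// KE.
  split; first by exists K.
  exists K; split=> // _ [w _ <-].
  have wd : dom Xi0dag (Xi0 w) by rewrite domE; exists w.
  (* [Xi0dag (Xi0 w)] may differ from [w], but [Xi0] maps both to the same vector, and [Ups0] sends
     it to [K (Xi0 w)]. *)
  by exists (Xi0dag (Xi0 w)) => //; rewrite dagK// KE.
Qed.
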